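(* Let $A:\mathbb{R}^n\rightarrow\mathbb{R}^n$ be a generalized oscillatory linear operator. Then all the eigenvalues of $A$ are simple, positive and different in modulus from each other: they can be numbered so that $$\rho(A)=\lambda_1>\lambda_2>\ldots>\lambda_n>0,$$ where $\rho(A)$ is the spectral radius of $A$.
   Context: A set $K\subset\mathbb{R}^N$ is a proper cone if it is a convex cone (for $x,y\in K$, $\alpha\ge 0$ one has $x+y,\alpha x\in K$), pointed ($K\cap(-K)=\{0\}$), closed and solid ($\mathrm{int}(K)\neq\emptyset$). A linear operator $B:\mathbb{R}^N\to\mathbb{R}^N$ is primitive with respect to a proper cone $K$ ($K$-primitive) if $BK\subseteq K$ and the only nonempty subset $S$ of the boundary $\partial(K)$ which is left invariant by $B$ (i.e. $BS\subseteq S$) is $\{0\}$. When $N=1$, the zero operator is not regarded as primitive (so for $N=1$ primitive means multiplication by a positive number). The $j$th exterior power $\wedge^jA$ of a linear operator $A$ on $\mathbb{R}^n$ is the linear operator on $\wedge^j\mathbb{R}^n$ defined by $(\wedge^jA)(x_1\wedge\ldots\wedge x_j)=Ax_1\wedge\ldots\wedge Ax_j$. The space $\wedge^j\mathbb{R}^n$ is identified with $\mathbb{R}^{C_n^j}$, $C_n^j=\frac{n!}{j!(n-j)!}$, via the basis $e_{i_1}\wedge\ldots\wedge e_{i_j}$, $1\le i_1<\ldots<i_j\le n$, where $e_1,\ldots,e_n$ is a basis of $\mathbb{R}^n$. In particular $\wedge^1A=A$, and $\wedge^nA$ is multiplication by $\det A$ on a one-dimensional space. A linear operator $A:\mathbb{R}^n\to\mathbb{R}^n$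 is called generalized oscillatory if it is primitive with respect to a proper cone $K_1\subset\mathbb{R}^n$, and for every $j=2,\ldots,n$ its $j$th exterior power $\wedge^jA$ is primitive with respect to a proper cone $K_j\subset\mathbb{R}^{C_n^j}$. *)

(* Defs.v *)
(* MathComp / MathComp-Analysis.  Vectors of R^N are rows, and a linear
   operator is a matrix B acting on them by x |-> x *m B, which is the
   convention of [eigenvalue]. *)
From mathcomp Require Import all_boot all_order all_algebra all_fingroup.
From mathcomp Require Import complex.
From mathcomp Require Import all_classical all_reals all_analysis.

Set Implicit Arguments.
Unset Strict Implicit.
Unset Printing Implicit Defensive.

Import Order.TTheory GRing.Theory Num.Theory.
Import numFieldNormedType.Exports.

Local Open Scope classical_set_scope.
Local Open Scope ring_scope.

Section Cones.
Variables (R : realType) (N : nat).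
Implicit Types (K S : set 'rV[R]_N) (B : 'M[R]_N).

(* Nonemptiness of K is implied by solidity. *)
Definition convex_cone K : Prop :=
  (forall x y, K x -> K y -> K (x + y)) /\
  (forall (a : R) x, 0 <= a -> K x -> K (a *: x)).

Definition proper_cone K : Prop :=
  [/\ convex_cone K,
      K `&` [set - x | x in K] = [set 0],
      closed K &
      interior K !=set0].

Definition boundary K : set 'rV[R]_N := closure K `\` interior K.

Definition invariant_under B S : Prop := forall x, S x -> S (x *m B).

(* For a proper cone and N >= 1, [set 0] is itself an invariant subset of the
   boundary, so only the uniqueness has to be required.  The last clause
   excludes the zero operator when N = 1: the other clauses would accept it,
   the boundary of a half-line being [set 0]. *)
Definition primitive_wrt K B : Prop :=
  [/\ invariant_under B K,
      (forall S, S !=set0 -> S `<=` boundary K -> invariant_under B S ->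
         S = [set 0]) &
      (N = 1%N -> B != 0)].

End Cones.

Section ExteriorPower.
Variables (R : comNzRingType) (n : nat).

(* The strictly increasing multi-indices i_1 < ... < i_j, numbered by
   'I_'C(n, j); the numbering fixes the order of the basis of the exterior
   power. *)
Definition multi_index j (I : 'I_'C(n, j)) : j.-tuple 'I_n :=
  enum_val (cast_ord (esym (card_ltn_sorted_tuples j n)) I).

(* Coordinates of x_1 /\ ... /\ x_j in the basis of the
   e_{i_1} /\ ... /\ e_{i_j}: the maximal minors of the matrix with rows x_k. *)
Definition wedge j (x : 'I_j -> 'rV[R]_n) : 'rV[R]_'C(n, j) :=
  \row_I \det (\matrix_(k < j, l < j) x k 0 (tnth (multi_index I) l)).

(* The operator sending each e_{i_1} /\ ... /\ e_{i_j} to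
   A e_{i_1} /\ ... /\ A e_{i_j}; see [wedge_delta] and [wedge_extpow]. *)
Definition extpow j (A : 'M[R]_n) : 'M[R]_'C(n, j) :=
  \matrix_(I < 'C(n, j))
    wedge (fun k : 'I_j => 'e_(tnth (multi_index I) k) *m A).

Lemma multi_index_sorted j (I : 'I_'C(n, j)) :
  sorted ltn [seq val i | i <- multi_index I].
Proof.
by have := enum_valP (cast_ord (esym (card_ltn_sorted_tuples j n)) I); rewrite inE.
Qed.

Lemma multi_index_inj j : injective (@multi_index j).
Proof. by move=> I J /enum_val_inj/cast_ord_inj. Qed.

Lemma tnth_multi_index_inj j (I : 'I_'C(n, j)) :
  injective (tnth (multi_index I)).
Proof.
apply/tuple_uniqP; rewrite -(map_inj_uniq val_inj).
exact: sorted_uniq ltn_trans ltnn _ (multi_index_sorted I).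
Qed.

Lemma multi_index_eq j (I J : 'I_'C(n, j)) :
  multi_index I =i multi_index J -> I = J.
Proof.
move=> eqIJ; apply: multi_index_inj; apply/val_inj/(inj_map val_inj).
apply: (irr_sorted_eq ltn_trans ltnn); rewrite ?multi_index_sorted // => i.
by apply/mapP/mapP => -[x xI ->]; exists x => //; rewrite ?eqIJ // -eqIJ.
Qed.

Let reparam j (p : 'I_'C(n, j) * 'S_j) : {ffun 'I_j -> 'I_n} :=
  [ffun k => tnth (multi_index p.1) (p.2 k)].

Let reparam_inj j : injective (@reparam j).
Proof.
move=> [I s] [J t] /ffunP eqf.
have eqk k : tnth (multi_index I) (s k) = tnth (multi_index J) (t k).
  by have := eqf k; rewrite !ffunE.
have eqIJ : I = J.
  apply: multi_index_eq => i; apply/tnthP/tnthP => -[k ->].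
    by exists (t ((s^-1)%g k)); rewrite -eqk permKV.
  by exists (s ((t^-1)%g k)); rewrite eqk permKV.
rewrite -eqIJ in eqk *; congr (_, _); apply/permP => k.
exact: tnth_multi_index_inj (eqk k).
Qed.

Let reparam_image j :
  [set reparam p | p in [set: 'I_'C(n, j) * 'S_j]%SET]%SET
  = [set f : {ffun 'I_j -> 'I_n} | injectiveb f]%SET.
Proof.
apply/eqP; rewrite eqEcard; apply/andP; split.
  apply/fintype.subsetP => f /imsetP [[I s] _ ->]; rewrite inE; apply/injectiveP => k l.
  by rewrite !ffunE => /tnth_multi_index_inj /perm_inj.
rewrite card_inj_ffuns !card_ord card_imset; last exact: reparam_inj.
rewrite cardsT card_prod card_ord card_Sn.
by rewrite bin_ffact.
Qed.

Lemma det_mulmx_rect j (X : 'M[R]_(j, n)) (B : 'M[R]_(n, j)) :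
  \det (X *m B) = \sum_(I < 'C(n, j))
    \det (colsub (tnth (multi_index I)) X) *
    \det (rowsub (tnth (multi_index I)) B).
Proof.
have -> : \det (X *m B) = \sum_(f : {ffun 'I_j -> 'I_n})
    (\prod_k X k (f k)) * \det (rowsub f B).
  rewrite /determinant.
  transitivity (\sum_(s : 'S_j) \sum_(f : {ffun 'I_j -> 'I_n})
      (-1) ^+ s * \prod_k (X k (f k) * B (f k) (s k))).
    apply: eq_bigr => s _; rewrite -big_distrr /=; congr (_ * _).
    rewrite -(bigA_distr_bigA (fun k i => X k i * B i (s k))) /=.
    by apply: eq_bigr => k _; rewrite mxE.
  rewrite exchange_big /=; apply: eq_bigr => f _; rewrite big_distrr /=.
  apply: eq_bigr => s _; rewrite big_split /= mulrCA; congr (_ * (_ * _)).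
  by apply: eq_bigr => k _; rewrite mxE.
rewrite (bigID (fun f : {ffun _} => injectiveb f)) /= [X in _ + X]big1 ?addr0.
  have -> : \sum_(f : {ffun 'I_j -> 'I_n} | injectiveb f)
       (\prod_k X k (f k)) * \det (rowsub f B) =
     \sum_(f in [set f : {ffun 'I_j -> 'I_n} | injectiveb f]%SET)
       (\prod_k X k (f k)) * \det (rowsub f B).
    by apply: eq_bigl => f; rewrite inE.
  rewrite -reparam_image big_imset /=; last by move=> ? ? _ _; exact: reparam_inj.
  rewrite (eq_bigl xpredT); last by move=> p; rewrite inE.
  rewrite -(pair_bigA _ (fun I s => (\prod_k X k (reparam (I, s) k)) *
     \det (rowsub (reparam (I, s)) B))) /=.
  apply: eq_bigr => I _; rewrite {2}/determinant big_distrl /=.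
  apply: eq_bigr => s _.
  have -> : rowsub (reparam (I, s)) B =
      row_perm s (rowsub (tnth (multi_index I)) B).
    by apply/matrixP => k l; rewrite !mxE ffunE.
  rewrite row_permE det_mulmx det_perm mulrCA mulrA; congr (_ * _ * _).
  by apply: eq_bigr => k _; rewrite mxE ffunE.
move=> f /injectivePn [k [l nkl eqfkl]].
by rewrite (determinant_alternate nkl) ?mulr0 // => i; rewrite !mxE eqfkl.
Qed.

Lemma wedge_delta j (I : 'I_'C(n, j)) :
  wedge (fun k => 'e_(tnth (multi_index I) k)) = 'e_I.
Proof.
apply/rowP => J; rewrite !mxE eqxx /=; have [->|nJI] := eqVneq J I.
  rewrite (_ : \matrix_(_, _) _ = 1%:M) ?det1 //; apply/matrixP => k l.
  by rewrite !mxE eqxx /= (inj_eq (@tnth_multi_index_inj _ _)) eq_sym.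
have [k kJ] : exists k, tnth (multi_index I) k \notin multi_index J.
  apply/existsP; apply: contraNT nJI => /existsPn IJ; apply/eqP/esym.
  have sIJ : {subset multi_index I <= multi_index J}.
    by move=> i /tnthP [k ->]; have := IJ k; rewrite negbK.
  apply: multi_index_eq; apply: (uniq_min_size _ sIJ _).2; last by rewrite !size_tuple.
  exact/tuple_uniqP/tnth_multi_index_inj.
rewrite (expand_det_row _ k) big1 // => l _; rewrite !mxE eqxx /=.
case: eqP => [eqJ|]; last by rewrite mul0r.
by rewrite -eqJ mem_tnth in kJ.
Qed.

Lemma wedge_extpow j (A : 'M[R]_n) (x : 'I_j -> 'rV[R]_n) :
  wedge x *m extpow j A = wedge (fun k => x k *m A).
Proof.
apply/rowP => L; rewrite !mxE.
rewrite (_ : \matrix_(_, _) _ = (\matrix_k x k) *m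
   colsub (tnth (multi_index L)) A); last first.
  apply/matrixP => k l; rewrite !mxE; apply: eq_bigr => i _.
  by rewrite !mxE.
rewrite det_mulmx_rect; apply: eq_bigr => I _; rewrite !mxE.
congr (_ * _); congr (determinant _).
  by apply/matrixP => k l; rewrite !mxE.
by apply/matrixP => k l; rewrite mxE -rowE !mxE.
Qed.

End ExteriorPower.

Definition generalized_oscillatory (R : realType) (n : nat) (A : 'M[R]_n) :
    Prop :=
  (exists2 K : set 'rV[R]_n, proper_cone K & primitive_wrt K A) /\
  (forall j : nat, (2 <= j <= n)%N ->
     exists2 K : set 'rV[R]_'C(n, j),
       proper_cone K & primitive_wrt K (extpow j A)).

Section Spectrum.
Variables (R : realType) (n : nat).

Definition complexify (A : 'M[R]_n) : 'M[R[i]]_n :=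
  map_mx (fun a : R => a%:C%C) A.

Definition complex_spectrum (A : 'M[R]_n) : set R[i] :=
  [set z | eigenvalue (complexify A) z].

Definition alg_mult (A : 'M[R]_n) (z : R[i]) : nat :=
  mup z (char_poly (complexify A)).

(* [normc] is the modulus with values in R, whereas `|z| lies in R[i]. *)
Definition spectral_radius (A : 'M[R]_n) : R :=
  sup [set ComplexField.Normc.normc z | z in complex_spectrum A].

End Spectrum.

(* Main.v *)
(* If B is primitive with respect to a proper cone K, it has an eigenvector x
   interior to K with eigenvalue r > 0, and a power of B / r sends each unit
   vector of K above a fixed multiple of x. It therefore contracts the width of
   the order intervals [a x, b x], so that every eigenvalue of B modulo the line
   of x has modulus less than r. Triangularize A over the complex numbers with
   diagonal t_1, ..., t_n of decreasing modulus. Then the j-th exterior power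
   of A is triangular with respect to the sum of the indices, and its Perron
   eigenvalue is t_1 ... t_j. Hence all these products are positive, and
   comparing with t_1 ... t_(j-1) t_(j+1) gives |t_(j+1)| < t_j. *)
Require Import Defs.
From mathcomp Require Import all_boot all_order all_algebra all_fingroup.
From mathcomp Require Import complex.
From mathcomp Require Import all_classical all_reals all_analysis.
From mathcomp Require Import ring.

Set Implicit Arguments.
Unset Strict Implicit.
Unset Printing Implicit Defensive.

Import Order.TTheory GRing.Theory Num.Theory.
Import numFieldNormedType.Exports.

Local Open Scope classical_set_scope.
Local Open Scope ring_scope.

(** * Primitive operators on a proper cone *)

Lemma mulmxr_continuous (R : realType) (N p : nat) (B : 'M[R]_(N, p)) :
  continuous (fun x : 'rV[R]_N => x *m B).
Proof.
have -> : (fun x : 'rV[R]_N => x *m B) =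
    (fun x : 'rV[R]_N => \sum_i x 0 i *: row i B).
  by apply/funext => x; rewrite mulmx_sum_row.
move=> x; apply: cvg_big; [exact: add_continuous|exact: nbhs_filter|move=> i _].
apply: (@cvgZr_tmp _ _ _ (nbhs x) (nbhs_filter x)); exact: coord_continuous.
Qed.

Section ProperCone.
Variables (R : realType) (N : nat) (K : set 'rV[R]_N).
Hypothesis K_proper : proper_cone K.

Let K_add x y : K x -> K y -> K (x + y).
Proof. by case: K_proper => -[+ _] _ _ _; exact. Qed.

Let K_scale (a : R) x : 0 <= a -> K x -> K (a *: x).
Proof. by case: K_proper => -[_ +] _ _ _; exact. Qed.

Let K_closed : closed K.
Proof. by case: K_proper. Qed.

Lemma cone0 : K 0.
Proof.
case: K_proper => _ _ _ [x /interior_subset Kx].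
by rewrite -(scale0r x); exact: K_scale.
Qed.

Lemma cone_pointed x : K x -> K (- x) -> x = 0.
Proof.
case: K_proper => _ Kp _ _ Kx KNx.
suff : [set 0] x by [].
by rewrite -Kp; split => //; exists (- x) => //; rewrite opprK.
Qed.

Lemma boundary_cone x : boundary K x <-> K x /\ ~ interior K x.
Proof. by rewrite /boundary -(closure_id K).1. Qed.

Lemma compact_cone_sphere : compact [set x | K x /\ `|x| = 1].
Proof.
apply: bounded_closed_compact.
  by exists 1; split=> // M M1 x [_ x1] /=; rewrite x1 ltW.
apply: closedI => //.
apply: (@preimage_closed _ _ (fun x : 'rV[R]_N => `|x|) [set 1]).
  by move=> x _; exact: norm_continuous.
exact: closed_eq.
Qed.

Lemma interior_cone_absorb x y : interior K x ->
  \forall e \near (0 : R), K (x + e *: y).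
Proof.
move=> Kx.
have : (fun e : R => x + e *: y) @ (0 : R) --> x + 0 *: y.
  by apply: cvgD; [exact: cvg_cst|apply: cvgZr_tmp; exact: cvg_id].
by rewrite scale0r addr0; apply.
Qed.

Lemma interior_cone_absorb_gt0 x y : interior K x ->
  exists2 e : R, 0 < e & K (x + e *: y).
Proof.
move=> /(interior_cone_absorb y)/nbhs_ballP[e /= e_gt0 xye].
exists (e / 2); first by rewrite divr_gt0.
apply: xye; rewrite /ball /= sub0r normrN gtr0_norm ?divr_gt0//.
by rewrite gtr_pMr// invf_lt1// ltr1n.
Qed.

Lemma interior_coneD x y : interior K x -> K y -> interior K (x + y).
Proof.
move=> Kx Ky; rewrite /interior.
have : (fun z => z - y) @ (x + y) --> x + y - y.
  apply: cvgB; [exact: nbhs_filter|exact: cvg_id|].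
  exact: (@cvg_cst _ _ _ _ (nbhs_filter _)).
rewrite addrK => /(_ _ Kx); apply: (@filterS _ _ (nbhs_filter _)) => z /= Kzy.
by rewrite -(subrK y z); exact: K_add.
Qed.

Lemma interior_coneZ (a : R) x : 0 < a -> interior K x -> interior K (a *: x).
Proof.
move=> a_gt0 Kx; rewrite /interior.
have : (fun z => a^-1 *: z) @ (a *: x) --> a^-1 *: (a *: x).
  by apply: cvgZl_tmp; [exact: nbhs_filter|exact: cvg_id].
rewrite scalerA mulVf ?gt_eqF// scale1r => /(_ _ Kx).
apply: (@filterS _ _ (nbhs_filter _)) => z /= Kz.
rewrite -[z]scale1r -(divff (lt0r_neq0 a_gt0)) -scalerA.
by apply: K_scale => //; exact: ltW.
Qed.

Hypothesis N_gt0 : (0 < N)%N.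

(** If 0 were interior, [K] would contain positive multiples of the all-ones row and of its
    opposite, against pointedness; [N_gt0] makes that row nonzero. *)
Lemma interior_cone_neq0 x : interior K x -> x != 0.
Proof.
move=> Kx; apply/eqP => x0; rewrite {}x0 in Kx.
have [e e_gt0] := interior_cone_absorb_gt0 (const_mx 1) Kx.
have [d d_gt0] := interior_cone_absorb_gt0 (- const_mx 1) Kx.
rewrite !add0r scalerN => /(K_scale (ltW e_gt0)) KN /(K_scale (ltW d_gt0)) KP.
have /rowP/(_ (Ordinal N_gt0)) : d *: (e *: const_mx 1) = 0 :> 'rV[R]_N.
  by apply: cone_pointed => //; rewrite scalerA mulrC -scalerA -scalerN.
by rewrite !mxE mulr1 => /eqP; rewrite mulf_eq0 !gt_eqF.
Qed.

(* Slide [w] along the line directed by an interior point [y]: the last point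
   of this line lying in [K] is on the boundary, and it is nonzero because [w]
   and [y] are independent. *)
Lemma boundary_cone_nonzero : (1 < N)%N -> exists2 p, boundary K p & p != 0.
Proof.
move=> N_gt1; case: (K_proper) => _ _ _ [y Ky].
have y_neq0 := interior_cone_neq0 Ky.
have [w wy] : exists w : 'rV[R]_N, forall a, w != a *: y.
  have /existsP[i yi] : [exists i, y 0 i != 0].
    apply: contraNT y_neq0 => /existsPn y0; apply/eqP/rowP => i.
    by apply/eqP; have := y0 i; rewrite negbK mxE.
  have [j ji] : exists j : 'I_N, j != i.
    have [i0|i0] := eqVneq i (Ordinal N_gt0).
      by exists (Ordinal N_gt1); rewrite i0.
    by exists (Ordinal N_gt0); rewrite eq_sym.
  exists ('e_j) => a; apply/eqP => /rowP yE.
  have := yE i; rewrite !mxE eqxx /= eq_sym (negbTE ji) => /esym/eqP.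
  rewrite mulf_eq0 (negbTE yi) orbF => /eqP a0.
  by have := yE j; rewrite !mxE !eqxx a0 mul0r => /eqP; rewrite oner_eq0.
pose S := [set s : R | K (w - s *: y)].
have S_ub : has_ubound S.
  have [e e_gt0 Kyw] := interior_cone_absorb_gt0 (- w) Ky.
  exists e^-1 => s Ss; rewrite leNgt; apply/negP => lt_es.
  have KNyw : K (- (y + e *: - w)).
    have := K_add (K_scale (ltW e_gt0) Ss)
      (K_scale (_ : 0 <= e * s - 1) (interior_subset Ky)).
    rewrite subr_ge0 -ler_pdivrMl// mulr1 => /(_ (ltW lt_es)); congr K.
    by apply/rowP => i; rewrite !mxE; ring.
  have /eqP := cone_pointed Kyw KNyw; rewrite scalerN subr_eq0 => /eqP yE.
  have /eqP := wy e^-1; apply.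
  by rewrite yE scalerA mulVf ?gt_eqF// scale1r.
have S_ne : S !=set0.
  have [e e_gt0 Kyw] := interior_cone_absorb_gt0 w Ky.
  exists (- e^-1); rewrite /S /=.
  have := K_scale (_ : 0 <= e^-1) Kyw; rewrite invr_ge0 => /(_ (ltW e_gt0)).
  congr K; rewrite scalerDr scalerA mulVf ?gt_eqF// scale1r.
  by rewrite addrC scaleNr opprK.
have S_closed : closed S.
  apply: preimage_closed K_closed => s _.
  by apply: cvgB; [exact: cvg_cst|apply: cvgZr_tmp; exact: cvg_id].
have S_sup : S (sup S).
  by rewrite [S in S _](closure_id S).1//; exact: closure_sup.
exists (w - sup S *: y); last by rewrite subr_eq0 wy.
apply/boundary_cone; split=> // /(interior_cone_absorb_gt0 (- y)) [e e_gt0].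
rewrite scalerN -addrA -opprD -scalerDl => Se.
by have := ub_le_sup S_ub Se; rewrite gerDl leNgt e_gt0.
Qed.

(** A solid cone spans the space: each ['e_i] is a multiple of a difference of two elements of
    [K]. *)
Lemma mulmx_eq0_cone (p : nat) (B : 'M[R]_(N, p)) :
  (forall x, K x -> x *m B = 0) -> B = 0.
Proof.
move=> KB0; case: (K_proper) => _ _ _ [u Ku].
apply/row_matrixP => i; rewrite row0 rowE.
have [e e_gt0 /KB0] := interior_cone_absorb_gt0 'e_i Ku.
rewrite mulmxDl KB0; last exact: interior_subset.
by rewrite add0r -scalemxAl => /eqP; rewrite scaler_eq0 gt_eqF// => /eqP.
Qed.

Section Primitive.
Variable B : 'M[R]_N.
Hypothesis B_prim : primitive_wrt K B.

Let K_inv x : K x -> K (x *m B).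
Proof. by case: B_prim => + _ _; exact. Qed.

Let K_invX k x : K x -> K (x *m (B ^+ k)).
Proof.
elim: k x => [|k IHk] x Kx; first by rewrite expr0 mulmx1.
by rewrite exprS mulmxA; exact/IHk/K_inv.
Qed.

(** For [N > 1], the zero operator would leave [[set p; 0]] invariant for a nonzero boundary point
    [p]; for [N = 1] the last clause of [primitive_wrt] applies. *)
Lemma primitive_neq0 : B != 0.
Proof.
case: B_prim => _ B_bd B1; have [/B1//|N_neq1] := eqVneq N 1%N.
have [|p p_bd /eqP p_neq0] := boundary_cone_nonzero.
  by rewrite ltn_neqAle eq_sym N_neq1.
apply/eqP => B0; suff : [set 0] p by exact: p_neq0.
rewrite -(B_bd [set p; 0]); first by left.
- by exists p; left.
- move=> _ [->//|->]; apply/boundary_cone; split; first exact: cone0.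
  by move/interior_cone_neq0; rewrite eqxx.
- by move=> x _; rewrite B0 mulmx0; right.
Qed.

(** An orbit never meeting the interior would be an invariant subset of the boundary, hence
    [[set 0]], yet it contains [x]. *)
Lemma primitive_orbit x : K x -> x != 0 -> exists k, interior K (x *m (B ^+ k)).
Proof.
case: B_prim => _ B_bd _ Kx /eqP x_neq0; apply/not_existsP => Nint.
suff : [set 0] x by exact: x_neq0.
rewrite -(B_bd [set x *m (B ^+ k) | k in [set: nat]]).
- by exists 0%N => //; rewrite expr0 mulmx1.
- by exists x; exists 0%N => //; rewrite expr0 mulmx1.
- by move=> _ [k _ <-]; apply/boundary_cone; split; [exact: K_invX|exact: Nint].
- by move=> _ [k _ <-]; exists k.+1 => //; rewrite exprSr -mulmxA.
Qed.

Let X := [set x | K x /\ `|x| = 1].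

Let X_normalize x : K x -> x != 0 -> X (`|x|^-1 *: x).
Proof.
move=> Kx x0; split; first by apply: K_scale => //; rewrite invr_ge0.
by rewrite normrZ normfV normr_id mulVf// normr_eq0.
Qed.

Let X_neq0 x : X x -> x != 0.
Proof. by case=> _ x1; rewrite -normr_eq0 x1 oner_eq0. Qed.

(* The eigenvalue is the least [s] such that [s *: x - x *m B] lies in [K] for
   some [x] in [K] of norm 1: if this vector were nonzero, applying a power of
   [B] would move it into the interior, leaving room for a smaller [s]. *)
Lemma primitive_eigenvector :
  exists r x, [/\ 0 < r, interior K x & x *m B = r *: x].
Proof.
case: (K_proper) => _ _ _ [u Ku].
have Xu := X_normalize (interior_subset Ku) (interior_cone_neq0 Ku).
have u_gt0 : 0 < `|u|^-1 by rewrite invr_gt0 normr_gt0 interior_cone_neq0.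
(* This [e] makes [s = e^-1] admissible for the normalized [u], so the minimization can be confined
   to the compact interval from 0 to [e^-1]. *)
have [e e_gt0 KuB] :=
  interior_cone_absorb_gt0 (- (`|u|^-1 *: u *m B)) (interior_coneZ u_gt0 Ku).
pose F (p : 'rV[R]_N * R) := p.2 *: p.1 - p.1 *m B.
pose D := (X `*` `[0, e^-1]) `&` (F @^-1` K).
have D_compact : compact D.
  apply: compact_closedI.
    by apply: compact_setX; [exact: compact_cone_sphere|exact: segment_compact].
  apply: preimage_closed K_closed => p _.
  have FF : Filter (nbhs p) := nbhs_filter p.
  apply: (@cvgB _ _ _ (nbhs p) FF).
    by apply: (@cvgZ _ _ _ (nbhs p) FF); [exact: cvg_snd|exact: cvg_fst].
  apply: (@continuous_comp _ _ _ fst (fun x : 'rV[R]_N => x *m B)).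
    exact: cvg_fst.
  exact: mulmxr_continuous.
have D_ne : D !=set0.
  exists (`|u|^-1 *: u, e^-1); split.
    by split => //=; rewrite in_itv/= lexx andbT invr_ge0 ltW.
  have := K_scale (_ : 0 <= e^-1) KuB; rewrite invr_ge0 => /(_ (ltW e_gt0)).
  rewrite /F /=; congr K; rewrite scalerDr; congr (_ + _).
  by rewrite scalerA mulVf ?gt_eqF// scale1r.
have [|[x s]] := compact_EVT_min D_ne D_compact (f := snd).
  by apply: continuous_subspaceT => p; exact: cvg_snd.
rewrite inE => -[[/= Xx]]; rewrite in_itv /= => /andP[s_ge0 s_le].
rewrite /F /= => KF s_min.
have [Kx x1] := Xx.
have F0 : s *: x - x *m B = 0.
  apply/eqP; apply/negPn/negP => F_neq0.
  have [k] := primitive_orbit KF F_neq0.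
  rewrite mulmxBl -scalemxAl -mulmxA.
  rewrite (_ : B *m B ^+ k = B ^+ k *m B); last exact: commrX.
  rewrite mulmxA; set x' := x *m B ^+ k => Kint.
  have Kx' : K x' by exact: K_invX.
  have s_gt0 : 0 < s.
    rewrite lt_neqAle s_ge0 andbT eq_sym; apply: contraNN F_neq0 => /eqP s0.
    rewrite s0 scale0r sub0r oppr_eq0; apply/eqP/cone_pointed; first exact: K_inv.
    by move: KF; rewrite s0 scale0r sub0r.
  have x'_neq0 : x' != 0.
    apply: contraTneq (interior_cone_neq0 Kint) => ->.
    by rewrite scaler0 mul0mx subrr eqxx.
  have [d d_gt0 Kd] := interior_cone_absorb_gt0 (- x') Kint.
  (* Lowering [s] by at most [d] keeps the vector in [K]; by at most [s], it keeps the new value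
     nonnegative. *)
  pose m := Num.min d s.
  have m_gt0 : 0 < m by rewrite lt_min d_gt0.
  have m_le_s : m <= s by rewrite ge_min lexx orbT.
  have m_le_d : m <= d by rewrite ge_min lexx.
  have : D (`|x'|^-1 *: x', s - m).
    split; first split => /=; first exact: X_normalize.
      by rewrite in_itv /= subr_ge0 m_le_s /= (le_trans _ s_le)// gerBl ltW.
    rewrite /F /= -scalemxAl scalerA mulrC -scalerA -scalerBr.
    apply: K_scale; first by rewrite invr_ge0.
    have := K_add Kd (K_scale (_ : 0 <= d - m) Kx'); rewrite subr_ge0 => /(_ m_le_d).
    by congr K; set y := x' *m B; apply/rowP => i; rewrite !mxE; ring.
  by move/mem_set/s_min => /=; rewrite lerDl oppr_ge0 leNgt m_gt0.
have xB : x *m B = s *: x by apply/esym/eqP; rewrite -subr_eq0 F0.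
have [k] := primitive_orbit Kx (X_neq0 Xx).
have xBk : x *m B ^+ k = s ^+ k *: x.
  elim: (k) => [|j IHj]; first by rewrite !expr0 mulmx1 scale1r.
  by rewrite exprSr mulmxA IHj -scalemxAl xB scalerA -exprSr.
rewrite xBk => Kk.
(* If [s = 0], a positive power of [B] sends [x] to 0, which is not interior; so [k = 0] and [x]
   itself is interior. As [B] kills [x], each [x - d *: f] in [K] forces the opposite of a multiple
   of [f *m B] into [K], whence [B = 0]. *)
have s_neq0 : s != 0.
  apply/eqP => s0; case: k Kk {xBk} => [|k]; last first.
    by rewrite s0 expr0n scale0r => /interior_cone_neq0; rewrite eqxx.
  rewrite expr0 scale1r => Kix; have /eqP := primitive_neq0; apply.
  apply: mulmx_eq0_cone => f Kf.
  have [d d_gt0 /K_inv] := interior_cone_absorb_gt0 (- f) Kix.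
  rewrite mulmxDl xB s0 scale0r add0r scalerN mulNmx -scalemxAl => KN.
  have /eqP := cone_pointed (K_scale (ltW d_gt0) (K_inv Kf)) KN.
  by rewrite scaler_eq0 gt_eqF// => /eqP.
have s_gt0 : 0 < s by rewrite lt_neqAle eq_sym s_neq0.
exists s, x; split=> //.
have := interior_coneZ (_ : 0 < (s ^+ k)^-1) Kk; rewrite invr_gt0 exprn_gt0// => /(_ isT).
by rewrite scalerA mulVf ?scale1r// expf_neq0.
Qed.

End Primitive.
End ProperCone.

(** * Dominance of the Perron eigenvalue *)

Section RealPart.
Variable R : realType.

Lemma ReD (a b : R[i]) : complex.Re (a + b) = complex.Re a + complex.Re b.
Proof. by case: a b => ? ? [? ?]. Qed.

Lemma Re_mulR (a : R[i]) (b : R) : complex.Re (a * b%:C%C) = complex.Re a * b.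
Proof. by case: a => ? ? /=; rewrite mulr0 subr0. Qed.

(** Real rows, to which the real cone applies. Letting [z] vary recovers the complex row, and a
    complex factor of [y] is absorbed into [z]. *)
Definition re_row (N : nat) (z : R[i]) (y : 'rV[R[i]]_N) : 'rV[R]_N :=
  \row_i complex.Re (z * y 0 i).

Lemma re_rowD N z (x y : 'rV[R[i]]_N) : re_row z (x + y) = re_row z x + re_row z y.
Proof. by apply/rowP => i; rewrite !mxE mulrDr ReD. Qed.

Lemma re_rowZ N z w (x : 'rV[R[i]]_N) : re_row z (w *: x) = re_row (z * w) x.
Proof. by apply/rowP => i; rewrite !mxE mulrA. Qed.

Lemma re_row_real N z (x : 'rV[R]_N) :
  re_row z (map_mx (real_complex R) x) = complex.Re z *: x.
Proof. by apply/rowP => i; rewrite !mxE Re_mulR. Qed.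

Lemma re_row_mul N z (y : 'rV[R[i]]_N) (B : 'M[R]_N) :
  re_row z (y *m complexify B) = re_row z y *m B.
Proof.
apply/rowP => i; rewrite !mxE big_distrr /= (big_morph _ ReD (erefl _)).
by apply: eq_bigr => j _; rewrite !mxE mulrA Re_mulR.
Qed.

End RealPart.

Section Perron.
Variables (R : realType) (N : nat) (K : set 'rV[R]_N) (B : 'M[R]_N).
Variables (r : R) (x : 'rV[R]_N).
Hypotheses (K_proper : proper_cone K) (N_gt0 : (0 < N)%N).
Hypotheses (B_prim : primitive_wrt K B) (r_gt0 : 0 < r) (Kx : interior K x).
Hypothesis xB : x *m B = r *: x.

Let K_add y z : K y -> K z -> K (y + z).
Proof. by case: K_proper => -[+ _] _ _ _; exact. Qed.

Let K_scale (a : R) y : 0 <= a -> K y -> K (a *: y).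
Proof. by case: K_proper => -[_ +] _ _ _; exact. Qed.

Let K_closed : closed K.
Proof. by case: K_proper. Qed.

Let K_x : K x.
Proof. exact: interior_subset. Qed.

Let x_neq0 : x != 0.
Proof. exact: interior_cone_neq0 Kx. Qed.

Let C := r^-1 *: B.

Let xC : x *m C = x.
Proof. by rewrite -scalemxAr xB scalerA mulVf ?gt_eqF// scale1r. Qed.

Let xCX k : x *m C ^+ k = x.
Proof.
by elim: k => [|k IHk]; rewrite ?expr0 ?mulmx1// exprS mulmxA xC.
Qed.

Let CX k : C ^+ k = r^-1 ^+ k *: B ^+ k.
Proof.
elim: k => [|k IHk]; first by rewrite !expr0 scale1r.
by rewrite !exprS IHk /C -!mulmxE -scalemxAl -scalemxAr scalerA.
Qed.

Let K_C y : K y -> K (y *m C).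
Proof.
case: B_prim => K_B _ _ Ky; rewrite -scalemxAr; apply: K_scale; last exact: K_B.
by rewrite invr_ge0 ltW.
Qed.

Let K_CX k y : K y -> K (y *m C ^+ k).
Proof.
elim: k y => [|k IHk] y Ky; first by rewrite expr0 mulmx1.
by rewrite exprS mulmxA; exact/IHk/K_C.
Qed.

(** By [primitive_orbit], some power of [C] sends a given unit vector of [K] into the interior,
    hence above a multiple of [x], and likewise its neighbours in [K]. Higher powers keep this bound
    because they fix [x] and preserve [K]; compactness and homogeneity conclude. The same [m] gives
    the exponent and the bound, so that one filter at infinity controls both. *)
Lemma perron_uniform_positivity :
  exists m : nat, forall y, K y -> K (y *m C ^+ m - (`|y| / m.+1%:R) *: x).
Proof.
pose X := [set y | K y /\ `|y| = 1].
have [m _ Xm] : \forall k \near \oo,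
    X `<=` [set y | K (y *m C ^+ k - k.+1%:R^-1 *: x)].
  move/compact_near_coveringP : (compact_cone_sphere K_proper); apply => y [Ky y1].
  have [|k0 Kk0] := primitive_orbit K_proper B_prim Ky.
    by rewrite -normr_eq0 y1 oner_eq0.
  have Kz : interior K (y *m C ^+ k0).
    rewrite CX -scalemxAr; apply: interior_coneZ => //.
    by rewrite exprn_gt0 ?invr_gt0.
  have [e e_gt0 Ke] := interior_cone_absorb_gt0 (- x) Kz.
  have half_gt0 : 0 < (2^-1 : R) by rewrite invr_gt0.
  (* The midpoint of an interior point and a point of [K] is interior, so halving [e] leaves room to
     move [y]. *)
  have Kze : interior K (y *m C ^+ k0 - (e / 2) *: x).
    have := interior_coneD K_proper (interior_coneZ K_proper half_gt0 Kz)
      (K_scale (ltW half_gt0) Ke).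
    set z := y *m _; congr (interior K); apply/rowP => i; rewrite !mxE.
    by field.
  have yk0 : \forall y' \near y, K (y' *m C ^+ k0 - (e / 2) *: x).
    have FF := nbhs_filter y.
    have : (fun y' => y' *m C ^+ k0 - (e / 2) *: x) @ y -->
       y *m C ^+ k0 - (e / 2) *: x.
      apply: (@cvgB _ _ _ (nbhs y) FF); first exact: mulmxr_continuous.
      exact: (@cvg_cst _ _ _ (nbhs y) FF).
    exact.
  have e2_gt0 : 0 < e / 2 by rewrite divr_gt0.
  exists ([set y' | K (y' *m C ^+ k0 - (e / 2) *: x)],
          [set k | (k0 <= k)%N /\ k.+1%:R^-1 < e / 2]).
    split=> //=; apply: filterI; first exact: nbhs_infty_ge.
    exact: (near_infty_natSinv_lt (PosNum e2_gt0)).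
  move=> [y' k] [/= Ky' [k0k ke]].
  have := K_add (K_CX (k - k0) Ky') (K_scale (_ : 0 <= e / 2 - k.+1%:R^-1) K_x).
  rewrite subr_ge0 => /(_ (ltW ke)).
  rewrite mulmxBl -scalemxAl xCX -mulmxA.
  have -> : C ^+ k0 *m C ^+ (k - k0) = C ^+ k by rewrite mulmxE -exprD subnKC.
  by congr K; rewrite scalerBl addrA subrK.
exists m => y Ky; have [->|y_neq0] := eqVneq y 0.
  by rewrite mul0mx normr0 mul0r scale0r subrr; exact: cone0.
have y_gt0 : 0 < `|y| by rewrite normr_gt0.
have /(_ (`|y|^-1 *: y)) := Xm m (leqnn m).
have XyE : X (`|y|^-1 *: y).
  split; first by apply: K_scale; rewrite // invr_ge0.
  by rewrite normrZ normfV normr_id mulVf ?gt_eqF.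
move=> /(_ XyE) /= /(K_scale (ltW y_gt0)).
by rewrite scalerBr -scalemxAl !scalerA mulfV ?gt_eqF// scale1r.
Qed.

(** In the order of [K], [d] bounds the Hopf oscillation of [u] relative to [x]. Recording a bound
    rather than the least width makes sums and multiples immediate. *)
Definition cone_osc (u : 'rV[R]_N) (d : R) :=
  exists a : R, K (u - a *: x) /\ K ((a + d) *: x - u).

Lemma cone_osc_le u d e : d <= e -> cone_osc u d -> cone_osc u e.
Proof.
move=> de [a [Kau Kub]]; exists a; split=> //.
have := K_add Kub (K_scale (_ : 0 <= e - d) K_x); rewrite subr_ge0 => /(_ de).
by congr K; apply/rowP => i; rewrite !mxE; ring.
Qed.

Lemma cone_oscD u v d e : cone_osc u d -> cone_osc v e -> cone_osc (u + v) (d + e).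
Proof.
move=> [a [Kau Kub]] [b [Kbv Kvc]]; exists (a + b); split.
  by have := K_add Kau Kbv; congr K; apply/rowP => i; rewrite !mxE; ring.
by have := K_add Kub Kvc; congr K; apply/rowP => i; rewrite !mxE; ring.
Qed.

Lemma cone_oscZ c u d : cone_osc u d -> cone_osc (c *: u) (`|c| * d).
Proof.
move=> [a [Kau Kub]]; have [c0|c0] := leP 0 c.
  rewrite ger0_norm//; exists (c * a); split.
    by have := K_scale c0 Kau; congr K; apply/rowP => i; rewrite !mxE; ring.
  by have := K_scale c0 Kub; congr K; apply/rowP => i; rewrite !mxE; ring.
have Nc0 : 0 <= - c by rewrite oppr_ge0 ltW.
rewrite ltr0_norm//; exists (c * (a + d)); split.
  by have := K_scale Nc0 Kub; congr K; apply/rowP => i; rewrite !mxE; ring.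
by have := K_scale Nc0 Kau; congr K; apply/rowP => i; rewrite !mxE; ring.
Qed.

Lemma cone_osc_shift c u d : cone_osc u d -> cone_osc (u + c *: x) d.
Proof.
move=> [a [Kau Kub]]; exists (a + c); split.
  by move: Kau; congr K; apply/rowP => i; rewrite !mxE; ring.
by move: Kub; congr K; apply/rowP => i; rewrite !mxE; ring.
Qed.

(** The interior point [x] is an order unit, so [u] lies between two multiples of it. *)
Lemma cone_osc_exists u : exists2 d, 0 <= d & cone_osc u d.
Proof.
have [e e0 Ke] := interior_cone_absorb_gt0 u Kx.
have [f f0 Kf] := interior_cone_absorb_gt0 (- u) Kx.
exists (e^-1 + f^-1); first by rewrite addr_ge0 ?invr_ge0 ?ltW.
have e'0 : 0 <= e^-1 by rewrite invr_ge0 ltW.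
have f'0 : 0 <= f^-1 by rewrite invr_ge0 ltW.
exists (- e^-1); split.
  have := K_scale e'0 Ke; congr K; apply/rowP => i; rewrite !mxE.
  by field; rewrite gt_eqF.
have := K_scale f'0 Kf; congr K; apply/rowP => i; rewrite !mxE.
by field; rewrite !gt_eqF.
Qed.

(** The supremum of the lower coefficients lies between the end coefficients of an order interval of
    width [e], for every [e]. As [e] tends to 0, closedness puts [u - sup L *: x] and its opposite
    in [K], and pointedness makes them vanish. *)
Lemma cone_osc_line u : (forall e, 0 < e -> cone_osc u e) -> exists a, u = a *: x.
Proof.
move=> osc_u.
have K_lim w : (forall e, 0 < e -> K (w + e *: x)) -> K w.
  move=> Kw; apply: (closed_cvg (F := (0 : R)^'+) (u_ := fun e : R => w + e *: x)) => //.
    by near=> e; apply: Kw.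
  rewrite -[X in _ --> X]addr0 -(scale0r x).
  apply: cvgD; [exact: cvg_cst|apply: cvgZr_tmp].
  exact: cvg_at_right_filter.
pose L := [set a | K (u - a *: x)].
have L_le a b e : L a -> K ((b + e) *: x - u) -> a <= b + e.
  move=> La Kb; rewrite leNgt; apply/negP => lt_ba.
  have ab_gt0 : 0 < a - (b + e) by rewrite subr_gt0.
  have KNx : K (- x).
    have := K_scale (_ : 0 <= (a - (b + e))^-1) (K_add La Kb).
    rewrite invr_ge0 => /(_ (ltW ab_gt0)); congr K.
    by apply/rowP => i; rewrite !mxE; field; rewrite gt_eqF.
  by move: x_neq0; rewrite (cone_pointed K_proper K_x KNx) eqxx.
have L_ub : has_ubound L.
  have [b [_ Kb]] := osc_u 1 ltr01.
  by exists (b + 1) => a La; exact: L_le La Kb.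
have supL e : 0 < e -> exists a,
    [/\ K (u - a *: x), K ((a + e) *: x - u) & a <= sup L <= a + e].
  move=> e0; have [a [Ka Kb]] := osc_u e e0; exists a; split=> //.
  apply/andP; split; first exact: ub_le_sup.
  by apply: ge_sup; [exists a|move=> b Lb; exact: L_le Lb Kb].
exists (sup L); apply/eqP; rewrite -subr_eq0; apply/eqP.
apply: (cone_pointed K_proper); apply: K_lim => e /supL[a [Ka Kb /andP[ha hb]]].
  have := K_add Ka (K_scale (_ : 0 <= a + e - sup L) K_x).
  rewrite subr_ge0 => /(_ hb); congr K.
  by apply/rowP => i; rewrite !mxE; ring.
have := K_add Kb (K_scale (_ : 0 <= sup L - a) K_x).
rewrite subr_ge0 => /(_ ha); congr K.
by apply/rowP => i; rewrite !mxE; ring.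
Unshelve. all: by end_near. Qed.

(** [C ^+ m] lifts each of the gaps [u - a *: x] and [(a + d) *: x - u] above its norm times
    [t *: x]. The gaps add up to [d *: x], so their norms sum to at least [d] times the norm of [x],
    and the width shrinks by a fixed factor. *)
Lemma cone_osc_contraction : exists (m : nat) (q : R), 0 <= q < 1 /\
  forall u d, cone_osc u d -> cone_osc (u *m C ^+ m) (q * d).
Proof.
have [m Km] := perron_uniform_positivity.
exists m, (1 - `|x| / m.+1%:R); split.
  apply/andP; split; last by rewrite gtrBl divr_gt0// normr_gt0.
  (* Were the factor negative, uniform positivity at the fixed vector [x] would put a negative
     multiple of [x] in [K]. *)
  rewrite leNgt; apply/negP => q_lt0.
  have := Km _ K_x; rewrite xCX -[X in X - _]scale1r -scalerBl.
  have q_inv : 0 <= - (1 - `|x| / m.+1%:R)^-1 by rewrite oppr_ge0 invr_le0 ltW.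
  move=> /(K_scale q_inv); rewrite scalerA mulNr mulVf ?lt_eqF// scaleN1r.
  by move=> /(cone_pointed K_proper K_x) /eqP; apply/negP.
move=> u d [a [Kau Kub]].
set D := C ^+ m; set t := m.+1%:R^-1 : R.
have t_ge0 : 0 <= t by rewrite invr_ge0.
pose y1 := u - a *: x; pose y2 := (a + d) *: x - u.
have y12 : d * `|x| <= `|y1| + `|y2|.
  apply: le_trans (ler_normD y1 y2).
  have -> : y1 + y2 = d *: x by apply/rowP => i; rewrite !mxE; ring.
  by rewrite normrZ ler_wpM2r// ler_norm.
apply: (@cone_osc_le _ (d - (`|y1| + `|y2|) * t)).
  rewrite mulrBl mul1r lerD2l lerN2 -/t [X in X <= _](_ : _ = d * `|x| * t).
    exact: ler_wpM2r.
  by ring.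
exists (a + `|y1| * t); split.
  have := Km _ Kau; rewrite -/t -/D mulmxBl -scalemxAl xCX -/y1.
  by congr K; set v := u *m D; apply/rowP => i; rewrite !mxE; ring.
have := Km _ Kub; rewrite -/t -/D mulmxBl -scalemxAl xCX -/y2.
by congr K; set v := u *m D; apply/rowP => i; rewrite !mxE; ring.
Qed.

Let xc := map_mx (real_complex R) x.

Let Cc := complexify C.

Let complexify_X k : complexify (C ^+ k) = Cc ^+ k.
Proof.
elim: k => [|k IHk]; first by rewrite !expr0; exact: map_scalar_mx.
by rewrite !exprS -!mulmxE -IHk; exact: map_mxM.
Qed.

Let xc_CX k : xc *m Cc ^+ k = xc.
Proof. by rewrite -complexify_X -map_mxM xCX. Qed.

(* The action of [B / r] modulo [x] contracts oscillations, so it has no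
   eigenvalue of modulus at least 1. *)
Lemma perron_dominance (y : 'rV[R[i]]_N) (mu c : R[i]) :
    (r%:C)%C <= `|mu| -> y *m complexify B = mu *: y + c *: xc ->
  exists a, y = a *: xc.
Proof.
move=> r_le yB; have [m [q [/andP[q_ge0 q_lt1] osc_q]]] := cone_osc_contraction.
pose rc : R[i] := (r%:C)%C.
have rc_gt0 : 0 < rc by rewrite ltcR.
pose nu := mu / rc.
have nu_ge1 : 1 <= `|nu|.
  by rewrite normf_div (gtr0_norm rc_gt0) ler_pdivlMr// mul1r.
have CcE : Cc = rc^-1 *: complexify B.
  by apply/matrixP => i j; rewrite !mxE rmorphM fmorphV.
(* Modulo [xc], the operator [Cc] multiplies [y] by [nu]. *)
have yC k : exists b, y *m Cc ^+ k = nu ^+ k *: y + b *: xc.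
  elim: k => [|k [b IHk]].
    by exists 0; rewrite !expr0 mulmx1 scale1r scale0r addr0.
  exists (nu ^+ k * (c / rc) + b); rewrite exprSr -mulmxE mulmxA IHk.
  have xcC : xc *m Cc = xc by rewrite -{2}(xc_CX 1) expr1.
  rewrite mulmxDl -!scalemxAl xcC {1}CcE -scalemxAr yB.
  by apply/rowP => i; rewrite !mxE exprSr /nu; ring.
have [b yCm] := yC m.
pose cosc d := forall z : R[i], `|z| <= 1 -> cone_osc (re_row z y) d.
have nu_neq0 : nu != 0 by rewrite -normr_gt0 (lt_le_trans ltr01).
(* As [nu] has modulus at least 1, [z / nu ^+ m] stays in the unit disc, and [C ^+ m] maps its real
   row to [re_row z y] up to a multiple of [x]. So the bound over the whole disc contracts by
   [q]. *)
have cosc_q d : cosc d -> cosc (q * d).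
  move=> Hd z z_le1; pose z' := z / nu ^+ m.
  have z'_le1 : `|z'| <= 1.
    rewrite normf_div normrX ler_pdivrMr ?exprn_gt0 ?normr_gt0//.
    by rewrite mul1r (le_trans z_le1)// exprn_ege1.
  have -> : re_row z y =
      re_row z' y *m C ^+ m + (- complex.Re (z' * b)) *: x.
    rewrite -re_row_mul complexify_X yCm re_rowD !re_rowZ divfK ?expf_neq0//.
    by rewrite re_row_real scaleNr addrK.
  exact/cone_osc_shift/osc_q/Hd.
have [d d_ge0 cosc_d] : exists2 d, 0 <= d & cosc d.
  have [d1 d1_ge0 osc1] := cone_osc_exists (re_row 1 y).
  have [d2 d2_ge0 osc2] := cone_osc_exists (re_row 'i%C y).
  exists (d1 + d2); first exact: addr_ge0.
  move=> z z_le1.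
  have Re_le1 (w : R[i]) : `|w| <= 1 -> `|complex.Re w| <= 1.
    by move=> w1; rewrite -lecR (le_trans (normc_ge_Re w)).
  have -> : re_row z y = complex.Re z *: re_row 1 y + complex.Im z *: re_row 'i%C y.
    apply/rowP => i; rewrite !mxE; case: z {z_le1} => a1 a2.
    by case: (y 0 i) => b1 b2 /=; ring.
  apply: cone_oscD.
    apply: (cone_osc_le _ (cone_oscZ _ osc1)).
    by rewrite ler_piMl// Re_le1.
  apply: (cone_osc_le _ (cone_oscZ _ osc2)).
  rewrite ler_piMl//.
  rewrite -normrN -ReiNIm Re_le1// normrM.
  by rewrite (_ : `|'i%C| = 1) ?mulr1// normc_def /= expr0n expr1n add0r sqrtr1.
have cosc_qX k : cosc (q ^+ k * d).
  elim: k => [|k IHk]; first by rewrite expr0 mul1r.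
  by rewrite exprS -mulrA; exact: cosc_q.
have cosc_small e : 0 < e -> cosc e.
  move=> e_gt0.
  have e' : 0 < e / (d + 1) by rewrite divr_gt0// ltr_wpDl.
  have q1 : `|q| < 1 by rewrite ger0_norm.
  have [k _ /(_ k (leqnn k)) qk] := (cvgr0Pnorm_lt _).1 (cvg_expr q1) _ e'.
  move=> z z1; apply: (cone_osc_le _ (cosc_qX k z z1)).
  move: qk; rewrite ger0_norm ?exprn_ge0// => qk.
  apply: le_trans (_ : e / (d + 1) * d <= _).
    by rewrite ler_wpM2r// ltW.
  rewrite mulrAC ler_pdivrMr ?ltr_wpDl// ler_wpM2l ?ltW//.
  by rewrite ltrDl.
have [a1 y1] : exists a, re_row 1 y = a *: x.
  by apply: cone_osc_line => e /cosc_small; apply; rewrite normr1.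
have [a2 y2] : exists a, re_row 'i%C y = a *: x.
  apply: cone_osc_line => e /cosc_small; apply.
  by rewrite normc_def /= expr0n expr1n add0r sqrtr1.
(* The real part of i times [y] is minus the imaginary part of [y], whence the sign of [a2]. *)
exists (Complex a1 (- a2)); apply/rowP => i; rewrite !mxE.
move/rowP/(_ i) : y1; move/rowP/(_ i) : y2; rewrite !mxE.
case: (y 0 i) => b1 b2 /=; rewrite !mul0r !mul1r sub0r subr0 => b2E ->.
apply/eqP; rewrite eq_complex /= mulr0 subr0 mulr0 add0r eqxx /=.
by rewrite -[b2]opprK b2E mulNr.
Qed.

End Perron.

(** * Triangularization and exterior powers *)

Lemma char_poly_similar (F : fieldType) n (P A T : 'M[F]_n) :
  P \in unitmx -> P *m A = T *m P -> char_poly A = char_poly T.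
Proof.
move=> P_unit PA; have PE :
    map_mx polyC P *m char_poly_mx A = char_poly_mx T *m map_mx polyC P.
  by rewrite mulmxBr mulmxBl scalar_mxC -!map_mxM PA.
have detP : \det (map_mx polyC P) != 0.
  by rewrite det_map_mx polyC_eq0 -unitfE.
apply: (mulfI detP); rewrite /char_poly -det_mulmx PE det_mulmx.
exact: mulrC.
Qed.

Lemma max_norm_seq (F : numDomainType) (s : seq F) : s != [::] ->
  exists2 z, z \in s & {in s, forall w, `|w| <= `|z|}.
Proof.
elim: s => // a [|b s] IHs _.
  by exists a; rewrite ?mem_head// => w; rewrite inE => /eqP ->.
have [//|z zs zmax] := IHs.
have [az|za] := real_leP (normr_real a) (normr_real z).
  exists z; first by rewrite in_cons zs orbT.
  by move=> w; rewrite in_cons => /predU1P[->//|/zmax].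
exists a; first exact: mem_head.
by move=> w; rewrite in_cons => /predU1P[->//|/zmax/le_trans]; apply; exact: ltW.
Qed.

(** In the rank factorization of [v], the left factor is a nonzero scalar and the middle one is
    ['e_0], so [v] is a multiple of the first row of the invertible right factor. *)
Lemma row_complete_unitmx (F : fieldType) n (v : 'rV[F]_n.+1) : v != 0 ->
  exists2 Q : 'M[F]_n.+1, Q \in unitmx & row 0 Q = v.
Proof.
move=> v_neq0; have rk : \rank v = 1%N by rewrite rank_rV v_neq0.
have := mulmx_ebase v; rewrite rk; set L := col_ebase v; set Q := row_ebase v.
have -> : pid_mx 1 = 'e_0 :> 'rV[F]_n.+1.
  by apply/rowP => j; rewrite !mxE eqxx andbT eq_sym.
rewrite -mulmxA -rowE [L]mx11_scalar mul_scalar_mx => vE.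
have L0 : L 0 0 != 0.
  by apply: contraNneq v_neq0 => L0; rewrite -vE L0 scale0r.
exists (L 0 0 *: Q); first by rewrite unitmxZ ?unitfE// row_ebase_unit.
by rewrite -vE; apply/rowP => j; rewrite !mxE.
Qed.

(** Deflation: an eigenvector for an eigenvalue of largest modulus becomes the first basis row, and
    induction treats the remaining block. The diagonal entries of that block are still roots of the
    characteristic polynomial of [A], so none exceeds the first in modulus. *)
Lemma ordered_triangularization (F : numClosedFieldType) n (A : 'M[F]_n) :
  exists P T : 'M[F]_n, [/\ P \in unitmx, P *m A = T *m P, is_trig_mx T &
    forall i j : 'I_n, (i <= j)%N -> `|T j j| <= `|T i i|].
Proof.
elim: n A => [|n IHn] A.
  exists 1%:M, A; split; rewrite ?unitmx1 ?mulmx1 ?mul1mx//.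
    by apply/is_trig_mxP => -[].
  by case.
have [s charE] := closed_field_poly_normal (char_poly A).
rewrite (monicP (char_poly_monic A)) scale1r in charE.
have s_neq0 : s != [::].
  have := size_char_poly A; rewrite charE size_prod_XsubC => -[s_size].
  by rewrite -size_eq0 s_size.
have [a a_s a_max] := max_norm_seq s_neq0.
have /eigenvalueP[v vA v_neq0] : eigenvalue A a.
  by rewrite eigenvalue_root_char charE root_prod_XsubC.
have [Q Q_unit Qv] := row_complete_unitmx v_neq0.
pose B : 'M[F]_(1 + n) := Q *m A *m invmx Q.
have BE : B = block_mx a%:M 0 (dlsubmx B) (drsubmx B).
  rewrite -[LHS]submxK; suff rowB : usubmx B = row_mx a%:M 0.
    by rewrite /ulsubmx /ursubmx rowB row_mxKl row_mxKr.
  have rowE0 (M : 'M[F]_(1 + n)) : usubmx M = row 0 M.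
    by apply/rowP => j; rewrite !mxE; congr (M _ j); apply: val_inj.
  rewrite rowE0 /B !row_mul Qv vA -scalemxAl -Qv -row_mul mulmxV// row1.
  apply/rowP => j; rewrite !mxE; case: splitP => [k|k] jk; rewrite !mxE.
    by rewrite (ord1 k) in jk *; rewrite (_ : j == 0) ?mulr1//; apply/eqP/val_inj.
  by rewrite (_ : j == 0 = false) ?mulr0//; apply/eqP => /(congr1 val); rewrite /= jk.
have [P' [T' [P'_unit P'B T'_trig T'_le]]] := IHn (drsubmx B).
pose P : 'M[F]_(1 + n) := block_mx 1%:M 0 0 P'.
pose T : 'M[F]_(1 + n) := block_mx a%:M 0 (P' *m dlsubmx B) T'.
have PB : P *m B = T *m P.
  rewrite {1}BE /P /T !mulmx_block !mul0mx !mulmx0 !mul1mx !mulmx1 !addr0 !add0r.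
  by rewrite P'B.
have PQ_unit : P *m Q \in unitmx.
  rewrite unitmx_mul Q_unit andbT unitmxE det_ublock det1 mul1r.
  by rewrite -unitmxE.
have PQA : P *m Q *m A = T *m (P *m Q).
  by rewrite mulmxA -PB /B !mulmxA mulmxKV.
have T_trig : is_trig_mx (T : 'M[F]_n.+1).
  have := @is_trig_block_mx _ 1 n 1 n a%:M 0 (P' *m dlsubmx B) T' erefl.
  rewrite eqxx T'_trig andbT /= => ->.
  by apply/is_trig_mxP => i j; rewrite !ord1.
exists (P *m Q), T; split=> // i j ij.
have Tj : T j j \in s.
  rewrite -root_prod_XsubC -charE (char_poly_similar PQ_unit PQA) char_poly_trig//.
  by rewrite (bigD1 j)//= rootM root_XsubC eqxx.
have T00 : T 0 0 = a.
  by rewrite -[0 : 'I_(1 + n)](lshift0 n 0) /T block_mxEul mxE eqxx.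
have [i0|i0] := eqVneq i 0; first by rewrite i0 T00 a_max.
have j0 : j != 0.
  apply: contraNneq i0 => j0; apply/eqP/val_inj => /=.
  by move: ij; rewrite j0 leqn0 => /eqP.
case: (unliftP 0 i) i0 ij => [i' ->|->]; last by rewrite eqxx.
case: (unliftP 0 j) j0 => [j' ->|->]; last by rewrite eqxx.
have Tdr (k : 'I_n) : T (lift 0 k) (lift 0 k) = T' k k.
  by have := block_mxEdr (a%:M : 'M[F]_1) 0 (P' *m dlsubmx B) T' k k; rewrite rshift1.
rewrite !Tdr => _ _ ij; apply: T'_le.
by rewrite -ltnS.
Qed.

Section ExteriorPowerTheory.
Variables (C : comNzRingType) (n j : nat).
Implicit Types (A B T : 'M[C]_n) (I J : 'I_'C(n, j)).

Lemma extpowE A I J : extpow j A I J =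
  \det (\matrix_(k < j, l < j) A (tnth (multi_index I) k) (tnth (multi_index J) l)).
Proof.
by rewrite !mxE; congr (\det _); apply/matrixP => k l; rewrite mxE -rowE !mxE.
Qed.

Lemma extpowM A B : extpow j (A *m B) = extpow j A *m extpow j B.
Proof.
apply/row_matrixP => I; rewrite row_mul.
have rowE A' : row I (extpow j A') = wedge (fun k => 'e_(tnth (multi_index I) k) *m A').
  by apply/rowP => J; rewrite !mxE.
by rewrite !rowE wedge_extpow; congr wedge; apply/funext => k; rewrite mulmxA.
Qed.

Lemma extpow1 : extpow j (1%:M : 'M[C]_n) = 1%:M.
Proof.
apply/row_matrixP => I; rewrite row1 -wedge_delta.
apply/rowP => J; rewrite !mxE; congr (\det _); apply/matrixP => k l.
by rewrite mxE mulmx1 [RHS]mxE.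
Qed.

(** A numerical grading compatible with the componentwise order of multi-indices. Its minimum is
    reached only at 0, 1, ..., j - 1, which locates the Perron entry. *)
Definition weight I : nat := \sum_(k < j) tnth (multi_index I) k.

(* A permutation [s] contributing to the minor [extpow j T I J] satisfies
   [J (s k) <= I k] for all [k], whence the comparison of weights. *)
Lemma extpow_trig T I J : is_trig_mx T ->
  extpow j T I J != 0 -> I = J \/ (weight J < weight I)%N.
Proof.
move=> /is_trig_mxP T_trig TIJ.
have [s sE] : exists s : 'S_j, forall k,
    (tnth (multi_index J) (s k) <= tnth (multi_index I) k)%N.
  apply: contrapT => /forallNP Ns; move/eqP: TIJ; apply; rewrite extpowE.
  rewrite /determinant big1// => s _.
  have /existsNP[k /negP] := Ns s; rewrite -ltnNge => lt_IJ.
  by rewrite (bigD1 k)//= mxE T_trig// mul0r mulr0.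
have wJ : weight J = (\sum_(k < j) tnth (multi_index J) (s k))%N.
  by rewrite /weight (reindex_inj (@perm_inj _ s)).
have [wIJ|] := leqP (weight I) (weight J); last by right.
left; have eqk k : tnth (multi_index J) (s k) = tnth (multi_index I) k.
  have [_] := leqif_sum (fun k (_ : true) => leqif_eq (sE k)).
  rewrite -wJ -/(weight I).
  have -> : weight J = weight I.
    by apply/eqP; rewrite eqn_leq wIJ andbT wJ; apply: leq_sum => k' _.
  by rewrite eqxx => /esym/forall_inP/(_ k isT)/eqP/val_inj.
apply: multi_index_eq => i; apply/tnthP/tnthP => -[k ->].
  by exists (s k); rewrite eqk.
by exists ((s^-1)%g k); rewrite -eqk permKV.
Qed.

Lemma multi_index_ge I (k l : 'I_j) : (k <= l)%N ->
  (tnth (multi_index I) k + (l - k) <= tnth (multi_index I) l)%N.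
Proof.
have srt := multi_index_sorted I.
have step (a : nat) (b : 'I_j) (c : 'I_j) : (b + a)%N = c ->
    (tnth (multi_index I) b + a <= tnth (multi_index I) c)%N.
  elim: a c => [|a IHa] c bc.
    by move: bc; rewrite !addn0 => /val_inj ->.
  have c'j : (b + a < j)%N by rewrite (leq_trans _ (ltn_ord c))// -bc addnS.
  have := IHa (Ordinal c'j) erefl; rewrite addnS => /leq_ltn_trans; apply.
  pose x0 := tnth (multi_index I) b.
  rewrite !(tnth_nth x0) -!(nth_map x0 0%N val) ?size_tuple ?ltn_ord//.
  apply: (sorted_ltn_nth ltn_trans 0%N srt);
    rewrite ?inE ?size_map ?size_tuple ?ltn_ord//.
  by rewrite /= -bc addnS.
by move=> kl; apply: step; rewrite subnKC.
Qed.

(** The indices increase, so the submatrix on the rows and columns of [I] is again lower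
    triangular. *)
Lemma extpow_trig_diag T I : is_trig_mx T ->
  extpow j T I I = \prod_(k < j) T (tnth (multi_index I) k) (tnth (multi_index I) k).
Proof.
move=> /is_trig_mxP T_trig; rewrite extpowE det_trig.
  by apply: eq_bigr => k _; rewrite mxE.
apply/is_trig_mxP => k l kl; rewrite mxE T_trig//.
apply: leq_trans (multi_index_ge I (ltnW kl)).
by rewrite -addn1 leq_add2l subn_gt0.
Qed.

End ExteriorPowerTheory.

Lemma extpow_unitmx (C : comUnitRingType) n j (A : 'M[C]_n) :
  A \in unitmx -> extpow j A \in unitmx.
Proof.
move=> A_unit; have AV : extpow j A *m extpow j (invmx A) = 1%:M.
  by rewrite -extpowM (mulmxV A_unit) extpow1.
exact: (mulmx1_unit AV).1.
Qed.

Lemma map_extpow (C D : comNzRingType) (f : {rmorphism C -> D}) n j (A : 'M[C]_n) :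
  map_mx f (extpow j A) = extpow j (map_mx f A).
Proof.
apply/matrixP => I J; rewrite mxE !extpowE -det_map_mx; congr (\det _).
by apply/matrixP => k l; rewrite !mxE.
Qed.

Section MultiIndex.
Variables (n j : nat).
Implicit Types I J : 'I_'C(n, j).

Lemma multi_index_surj (t : j.-tuple 'I_n) :
  sorted ltn [seq val i | i <- t] -> exists I, multi_index I = t.
Proof.
move=> t_sorted; have tS : t \in [set t : j.-tuple 'I_n | sorted ltn (map val t)]%SET.
  by rewrite inE.
exists (cast_ord (card_ltn_sorted_tuples j n) (enum_rank_in tS t)).
by rewrite /multi_index cast_ordK enum_rankK_in.
Qed.

Lemma multi_index_of_fun (f : 'I_j -> 'I_n) : {homo f : k l / (k < l)%N} ->
  exists I, forall k, tnth (multi_index I) k = f k.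
Proof.
move=> f_mono; have [|I IE] := @multi_index_surj [tuple f k | k < j].
  rewrite /= -map_comp; apply: (homo_sorted (e := relpre val ltn)).
    by move=> k l; exact: f_mono.
  by rewrite -sorted_map val_enum_ord iota_ltn_sorted.
by exists I => k; rewrite IE tnth_mktuple.
Qed.

Lemma multi_index_ge_id I (k : 'I_j) : (k <= tnth (multi_index I) k)%N.
Proof.
have j_gt0 : (0 < j)%N by exact: leq_ltn_trans (ltn_ord k).
have := @multi_index_ge n j I (Ordinal j_gt0) k (leq0n k).
by rewrite subn0; apply: leq_trans; exact: leq_addl.
Qed.

(** Every multi-index dominates 0, 1, ..., j - 1 componentwise, so a sum that is no larger forces
    equality in each entry. *)
Lemma multi_index_first I0 J :
    (forall k, tnth (multi_index I0) k = k :> nat) ->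
  (weight J <= weight I0)%N -> J = I0.
Proof.
move=> I0E wJ; have geJ k : (tnth (multi_index I0) k <= tnth (multi_index J) k)%N.
  by rewrite I0E multi_index_ge_id.
apply: multi_index_inj; apply: eq_from_tnth => k.
have [_] := leqif_sum (fun k (_ : true) => leqif_eq (geJ k)).
rewrite -/(weight I0) -/(weight J) eqn_leq wJ andbT.
have -> : (weight I0 <= weight J)%N by apply: leq_sum => k' _.
by move=> /esym/forall_inP/(_ k isT)/eqP/val_inj.
Qed.

End MultiIndex.

(* The Perron eigenvalue is a diagonal entry of [S], hence the dominant one, and
   the rows [I0] and [I1] of [P] span an invariant subspace to which
   [perron_dominance] applies. *)
Lemma perron_triangular (R : realType) (N : nat) (K : set 'rV[R]_N)
    (B : 'M[R]_N) (P S : 'M[R[i]]_N) (w : 'I_N -> nat) (I0 : 'I_N) :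
    proper_cone K -> primitive_wrt K B ->
    P \in unitmx -> P *m complexify B = S *m P ->
    (forall I J, S I J != 0 -> I = J \/ (w J < w I)%N) ->
    (forall J, (w J <= w I0)%N -> J = I0) ->
    (forall J, `|S J J| <= `|S I0 I0|) ->
  0 < S I0 I0 /\
  forall I1, I1 != I0 -> (forall J, (w J < w I1)%N -> J = I0) ->
    `|S I1 I1| < S I0 I0.
Proof.
move=> K_proper B_prim P_unit PB S_trig I0_min I0_max.
have N_gt0 : (0 < N)%N by exact: leq_ltn_trans (ltn_ord I0).
have [r [x [r_gt0 Kx xB]]] := primitive_eigenvector K_proper N_gt0 B_prim.
pose xc : 'rV[R[i]]_N := map_mx (real_complex R) x.
pose rc : R[i] := (r%:C)%C.
have rc_gt0 : 0 < rc by rewrite ltcR.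
have xcB : xc *m complexify B = rc *: xc.
  by rewrite -map_mxM xB; apply/rowP => i; rewrite !mxE rmorphM.
have xc_neq0 : xc != 0.
  rewrite map_mx_eq0; exact: interior_cone_neq0 Kx.
(* Expand the Perron eigenvector in the rows of [P] and take [I] of largest weight in its support:
   column [I] of the eigenvalue equation reduces to its diagonal term, so [rc] is [S I I]. *)
have rc_le : rc <= `|S I0 I0|.
  pose z := xc *m invmx P.
  have zP : z *m P = xc by rewrite mulmxKV.
  have zS : z *m S = rc *: z.
    apply: (can_inj (mulmxK P_unit)).
    by rewrite -mulmxA -PB mulmxA zP xcB -scalemxAl zP.
  have [I' zI'] : exists I, z 0 I != 0.
    apply/existsP; apply: contraNT xc_neq0 => /existsPn z0; rewrite -zP.
    suff -> : z = 0 by rewrite mul0mx.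
    by apply/rowP => i; rewrite [RHS]mxE; apply/eqP; have := z0 i; rewrite negbK.
  have [I zI I_max] := @arg_maxnP _ I' (fun I => z 0 I != 0) w zI'.
  suff SII : S I I = rc by rewrite -(gtr0_norm rc_gt0) -SII I0_max.
  have /rowP/(_ I) := zS; rewrite [LHS]mxE [RHS]mxE (bigD1 I)//= big1 ?addr0 => [|J JI].
    by rewrite mulrC => /(mulIf zI).
  have [->|zJ] := eqVneq (z 0 J) 0; first by rewrite mul0r.
  have [->|SJI] := eqVneq (S J I) 0; first by rewrite mulr0.
  have [JE|lt_IJ] := S_trig _ _ SJI; first by rewrite JE eqxx in JI.
  by have := I_max _ zJ; rewrite /= leqNgt lt_IJ.
have rowP_B I : row I P *m complexify B = row I S *m P.
  by rewrite -row_mul PB row_mul.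
(* No other index has weight at most that of [I0], so row [I0] of [P] is an eigenvector. *)
have rowS0 : row I0 S = S I0 I0 *: 'e_I0.
  apply/rowP => J; rewrite !mxE eqxx /=.
  have [->|JI0] := eqVneq J I0; first by rewrite mulr1.
  rewrite mulr0; apply/eqP/negPn/negP => /S_trig[JE|/ltnW/I0_min JE];
    by rewrite JE eqxx in JI0.
have [a rowPa] : exists a, row I0 P = a *: xc.
  have dom := perron_dominance K_proper N_gt0 B_prim r_gt0 Kx xB.
  apply: (dom _ _ 0 rc_le).
  by rewrite rowP_B rowS0 -scalemxAl -rowE scale0r addr0.
have a_neq0 : a != 0.
  apply/eqP => a0; have /(congr1 (mulmx^~ (invmx P))) : row I0 P = 0.
    by rewrite rowPa a0 scale0r.
  rewrite -row_mul mulmxV// mul0mx row1 => /rowP/(_ I0).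
  by rewrite !mxE !eqxx => /eqP; rewrite oner_eq0.
have S00 : S I0 I0 = rc.
  have := rowP_B I0; rewrite rowS0 -scalemxAl -rowE rowPa -scalemxAl xcB.
  rewrite !scalerA mulrC => /eqP; rewrite -subr_eq0 -scalerBl scaler_eq0.
  rewrite (negbTE xc_neq0) orbF.
  by rewrite subr_eq0 => /eqP/(mulIf a_neq0).
split; first by rewrite S00.
move=> I1 I10 I1_next; rewrite S00.
(* Otherwise row [I1] of [P], an eigenvector modulo [xc], would like row [I0] be a multiple of [xc],
   which the invertibility of [P] forbids. *)
rewrite real_ltNge ?normr_real ?gtr0_real//; apply/negP => rc_le1.
have rowS1 : row I1 S = S I1 I1 *: 'e_I1 + S I1 I0 *: 'e_I0.
  apply/rowP => J; rewrite !mxE eqxx /=; have [->|JI1] := eqVneq J I1.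
    by rewrite (negbTE I10) mulr1 mulr0 addr0.
  rewrite mulr0 add0r; have [->|JI0] := eqVneq J I0; first by rewrite mulr1.
  rewrite mulr0; apply/eqP/negPn/negP => /S_trig[JE|/I1_next JE].
    by rewrite JE eqxx in JI1.
  by rewrite JE eqxx in JI0.
have [b rowPb] : exists b, row I1 P = b *: xc.
  have dom := perron_dominance K_proper N_gt0 B_prim r_gt0 Kx xB.
  apply: (dom _ _ (S I1 I0 * a) rc_le1).
  by rewrite rowP_B rowS1 mulmxDl -!scalemxAl -!rowE rowPa scalerA.
have : (a *: 'e_I1 - b *: 'e_I0 : 'rV[R[i]]_N) *m P = 0.
  by rewrite mulmxDl mulNmx -!scalemxAl -!rowE rowPa rowPb !scalerA mulrC subrr.
move=> /(congr1 (mulmx^~ (invmx P))); rewrite mulmxK// mul0mx => /rowP/(_ I1).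
rewrite !mxE !eqxx (negbTE I10) mulr1 mulr0 subr0 => a0.
by rewrite a0 eqxx in a_neq0.
Qed.

(** * Positivity and strict ordering of the eigenvalues *)

Section Oscillatory.
Variables (R : realType) (n : nat) (A : 'M[R]_n) (P T : 'M[R[i]]_n).
Hypotheses (A_osc : generalized_oscillatory A) (P_unit : P \in unitmx).
Hypotheses (PA : P *m complexify A = T *m P) (T_trig : is_trig_mx T).
Hypothesis T_le : forall k l : 'I_n, (k <= l)%N -> `|T l l| <= `|T k k|.

(** Indexing the diagonal by naturals, with default 0 out of range, spares bound proofs in products
    over initial segments. *)
Let d (k : nat) : R[i] := if insub k is Some i then T i i else 0.

Let dE (k : 'I_n) : d k = T k k.
Proof. by rewrite /d valK. Qed.

(** This is [perron_triangular] for the exterior power of order [j.+1], at the lightest multi-index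
    0, ..., j and the next one, where j + 1 replaces j. Order 1 is treated apart, on [A] itself, the
    index serving as weight. *)
Lemma osc_prod_gt0 j : (j < n)%N ->
  0 < \prod_(k < j.+1) d k /\
  ((j.+1 < n)%N -> `|(\prod_(k < j) d k) * d j.+1| < \prod_(k < j.+1) d k).
Proof.
move=> lt_jn; case: A_osc => [[K1 K1_proper A_prim] ext_osc].
case: j lt_jn => [|j] lt_jn.
  have /is_trig_mxP T0 := T_trig.
  rewrite big_ord0 mul1r big_ord1 (dE (Ordinal lt_jn)).
  have [|||T_gt0 T_lt] := @perron_triangular _ _ _ _ P T val (Ordinal lt_jn)
    K1_proper A_prim P_unit PA.
  - move=> k l Tkl; case: (ltngtP k l) => [/T0 Tkl0|lt_lk|/val_inj->].
    + by rewrite Tkl0 eqxx in Tkl.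
    + by right.
    + by left.
  - by move=> k /=; rewrite leqn0 => /eqP k0; apply/val_inj.
  - by move=> k; exact: T_le.
  split=> // lt_1n; rewrite (dE (Ordinal lt_1n)); apply: T_lt => //.
  by move=> k /=; rewrite ltnS leqn0 => /eqP k0; apply/val_inj.
have [|K K_proper K_prim] := ext_osc j.+2; first by [].
have [I0 I0E] := @multi_index_of_fun n j.+2 (fun k => widen_ord lt_jn k) (fun _ _ => id).
pose extP := extpow j.+2 P; pose extT := extpow j.+2 T.
have extP_unit : extP \in unitmx := extpow_unitmx j.+2 P_unit.
have extPA : extP *m complexify (extpow j.+2 A) = extT *m extP.
  by rewrite /complexify map_extpow -!extpowM PA.
have diag0 : extT I0 I0 = \prod_(k < j.+2) d k.
  rewrite extpow_trig_diag//; apply: eq_bigr => k _.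
  by rewrite -dE I0E.
have [|||extT_gt0 extT_lt] := @perron_triangular _ _ _ _ extP extT
  (@weight n j.+2) I0 K_proper K_prim extP_unit extPA.
- by move=> I J; exact: extpow_trig.
- by move=> J; apply: multi_index_first => k; rewrite I0E.
- move=> J; rewrite !extpow_trig_diag// !normr_prod; apply: ler_prod => k _.
  by rewrite normr_ge0 T_le// I0E /= multi_index_ge_id.
rewrite -diag0; split=> // lt_j2n.
(* The multi-index 0, ..., j, j + 2, whose weight exceeds that of [I0] by one. *)
pose f (k : 'I_j.+2) : 'I_n := if k == ord_max then Ordinal lt_j2n else widen_ord lt_jn k.
have f_mono : {homo f : k l / (k < l)%N}.
  move=> k l kl; rewrite /f; have [kmax|kmax] := eqVneq k ord_max.
    by move: kl; rewrite kmax /= ltnNge -ltnS ltn_ord.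
  have [lmax|lmax] := eqVneq l ord_max; last by [].
  exact: (ltn_ord k).
have [I1 I1E] := multi_index_of_fun f_mono.
have f_widen (k : 'I_j.+1) : f (widen_ord (leqnSn _) k) = k :> nat.
  by rewrite /f ifF//; apply/eqP => /(congr1 val) /=; apply/eqP; rewrite ltn_eqF.
have f_max : f ord_max = j.+2 :> nat by rewrite /f eqxx.
have wI1 : weight I1 = (weight I0).+1.
  rewrite /weight big_ord_recr [in RHS]big_ord_recr /= I1E f_max I0E /= addnS; congr (_ + _).+1.
  by apply: eq_bigr => k _; rewrite I1E I0E f_widen.
have diag1 : extT I1 I1 = (\prod_(k < j.+1) d k) * d j.+2.
  rewrite extpow_trig_diag// big_ord_recr /= -!dE I1E f_max; congr (_ * _).
  by apply: eq_bigr => k _; rewrite -dE I1E f_widen.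
rewrite -diag1; apply: extT_lt.
  by apply/eqP => I10; have /eqP := wI1; rewrite I10 eqn_leq ltnn andbF.
by move=> J; rewrite wI1 ltnS; apply: multi_index_first => k; rewrite I0E.
Qed.

Let prod_gt0 j : (j <= n)%N -> 0 < \prod_(k < j) d k.
Proof. by case: j => [|j] ltj; [rewrite big_ord0|case: (osc_prod_gt0 ltj)]. Qed.

Lemma osc_diag_gt0 (k : 'I_n) : 0 < T k k.
Proof.
have := prod_gt0 (ltn_ord k); rewrite big_ord_recr /= -dE.
by rewrite pmulr_rgt0// prod_gt0// ltnW.
Qed.

(** Cancelling the product of the first [k] entries in [osc_prod_gt0] settles consecutive indices;
    [T_le] extends this to every later [l]. *)
Lemma osc_diag_lt (k l : 'I_n) : (k < l)%N -> T l l < T k k.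
Proof.
move=> kl; have lt_k1n : (k.+1 < n)%N by exact: leq_ltn_trans (ltn_ord l).
have [_ /(_ lt_k1n)] := osc_prod_gt0 (ltn_ord k).
have prodk := prod_gt0 (ltnW (ltn_ord k)).
rewrite big_ord_recr /= normrM (gtr0_norm prodk) ltr_pM2l// dE (dE (Ordinal lt_k1n)).
apply: le_lt_trans; rewrite -(gtr0_norm (osc_diag_gt0 l)).
exact: T_le.
Qed.

End Oscillatory.

Lemma normc_real (R : realType) (a : R) : ComplexField.Normc.normc (a%:C)%C = `|a|.
Proof. by rewrite /= expr0n addr0 sqrtr_sqr. Qed.

Theorem theorem3 (R : realType) (n : nat) (n_gt0 : (0 < n)%N) (A : 'M[R]_n)
    (A_osc : generalized_oscillatory A) :
  (forall z : R[i], complex_spectrum A z -> 0 < z /\ alg_mult A z = 1%N) /\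
  (forall z w : R[i], complex_spectrum A z -> complex_spectrum A w ->
     ComplexField.Normc.normc z = ComplexField.Normc.normc w -> z = w) /\
  (exists lambda : 'I_n -> R,
     [/\ complex_spectrum A = [set (lambda k)%:C%C | k in [set: 'I_n]],
         spectral_radius A = lambda (Ordinal n_gt0),
         (forall k l : 'I_n, (k < l)%N -> lambda l < lambda k) &
         (forall k : 'I_n, 0 < lambda k)]).
Proof.
have [P [T [P_unit PA T_trig T_le]]] := ordered_triangularization (complexify A).
have T_gt0 := osc_diag_gt0 A_osc P_unit PA T_trig T_le.
have T_lt := osc_diag_lt A_osc P_unit PA T_trig T_le.
(* A complex number that is positive in this order is real, so taking real parts loses nothing. *)
pose lambda (k : 'I_n) : R := complex.Re (T k k).
have TE k : T k k = ((lambda k)%:C)%C.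
  by rewrite RRe_real// gtr0_real.
have lambda_gt0 k : 0 < lambda k by rewrite -ltcR -TE.
have lambda_lt (k l : 'I_n) : (k < l)%N -> lambda l < lambda k.
  by move=> /T_lt; rewrite !TE ltcR.
have charE : char_poly (complexify A) =
    \prod_(z <- [seq ((lambda k)%:C)%C | k <- enum 'I_n]) ('X - z%:P).
  rewrite (char_poly_similar P_unit PA) char_poly_trig// big_map big_enum /=.
  by apply: eq_bigr => k _; rewrite TE.
have specE : complex_spectrum A = [set (lambda k)%:C%C | k in [set: 'I_n]].
  apply/seteqP; split=> z;
    rewrite /complex_spectrum /= eigenvalue_root_char charE root_prod_XsubC.
    by move=> /mapP[k _ ->]; exists k.
  by move=> [k _ <-]; apply/map_f; rewrite mem_enum.
have lambda_inj : injective lambda.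
  move=> k l kl; apply/val_inj; case: (ltngtP k l) => // /lambda_lt.
    by rewrite kl ltxx.
  by rewrite kl ltxx.
rewrite specE; split; [|split].
- move=> _ [k _ <-]; split; first by rewrite ltcR.
  (* The roots listed in [charE] are distinct because [lambda] is injective. *)
  rewrite /alg_mult charE mu_prod_XsubC count_uniq_mem.
    by case: mapP => // -[]; exists k; rewrite ?mem_enum.
  by rewrite map_inj_uniq ?enum_uniq// => a b /complexI/lambda_inj.
- move=> _ _ [k _ <-] [l _ <-]; rewrite !normc_real !gtr0_norm//.
  by move=> ->.
exists lambda; split=> //; rewrite /spectral_radius specE.
have normE : [set ComplexField.Normc.normc z |
      z in [set (lambda k)%:C%C | k in [set: 'I_n]]] =
    [set lambda k | k in [set: 'I_n]].
  rewrite image_comp; apply: eq_imagel => k _ /=.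
  by rewrite -[RHS](gtr0_norm (lambda_gt0 k)) -normc_real.
rewrite normE.
have lambda_ub : ubound [set lambda k | k in [set: 'I_n]] (lambda (Ordinal n_gt0)).
  move=> _ [k _ <-]; have [->//|k0] := eqVneq k (Ordinal n_gt0).
  by apply/ltW/lambda_lt; rewrite lt0n.
apply/le_anti/andP; split.
  by apply: ge_sup => //; exists (lambda (Ordinal n_gt0)); exists (Ordinal n_gt0).
by apply: ub_le_sup; [exists (lambda (Ordinal n_gt0))|exists (Ordinal n_gt0)].
Qed.
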